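(* There is an algorithm running in time $O(d)$ (linear time) that, given a ranking $\pi\in\mathcal{S}_d$, a partition of $[d]$ into $g$ groups $G_1,\dots,G_g$ (for some $g\in\mathbb{N}$), vectors $\bar{\alpha}=(\alpha_1,\dots,\alpha_g)\in[0,1]^g$, $\bar{\beta}=(\beta_1,\dots,\beta_g)\in[0,1]^g$ and $k\in[d]$, outputs a closest $(\bar{\alpha},\bar{\beta})$-$k$-fair ranking to $\pi$ under the Kendall tau distance, i.e., an $(\bar{\alpha},\bar{\beta})$-$k$-fair ranking $\pi^*$ minimizing $\mathcal{K}(\pi,\pi^* )$ over all $(\bar{\alpha},\bar{\beta})$-$k$-fair rankings.
   Context: $\mathcal{S}_d$ denotes the set of all rankings (permutations) of $[d]=\{1,\dots,d\}$; a ranking $\pi$ is viewed as the sequence $\pi(1),\dots,\pi(d)$, and $x<_\pi y$ means $x$ appears before $y$ in $\pi$. The $k$-length prefix of $\pi$ is the set $\{\pi(1),\dots,\pi(k)\}$. The Kendall tau distance is $\mathcal{K}(\pi_1,\pi_2)=|\{(a,b)\in[d]\times[d]: a<_{\pi_1}b \text{ but } b<_{\pi_2}a\}|$. A ranking $\pi$ is $(\bar{\alpha},\bar{\beta})$-$k$-fair if its $k$-length prefix $P$ satisfies $\lfloor\alpha_i k\rfloor\le|P\cap G_i|\le\lceil\beta_i k\rceil$ for every $i\in[g]$. Convention: if no fair ranking exists, the algorithm may instead report that no fair ranking exists. *)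

(* Defs.v *)
From mathcomp Require Import all_boot all_order all_fingroup all_algebra.
From mathcomp Require Import reals.

Set Implicit Arguments.
Unset Strict Implicit.
Unset Printing Implicit Defensive.

Import Order.TTheory GRing.Theory Num.Theory.
Local Open Scope ring_scope.

(* [d] is represented by 'I_d, i.e. elements and positions are numbered from 0.
   A ranking p : 'S_d is read as the sequence p 0, ..., p (d - 1), so that
   p i is the element at position i and p^-1 x is the position of x. *)
Definition before (d : nat) (p : 'S_d) (x y : 'I_d) : bool :=
  ((p^-1)%g x < (p^-1)%g y)%N.

Definition kendall_tau (d : nat) (p1 p2 : 'S_d) : nat :=
  #|[set ab : 'I_d * 'I_d | before p1 ab.1 ab.2 && before p2 ab.2 ab.1]|.

Definition prefix_set (d : nat) (p : 'S_d) (k : nat) : {set 'I_d} :=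
  [set p i | i : 'I_d & (i < k)%N].

(* Parts are nonempty, by the definition of [partition], and [injective G]
   makes distinct indices name distinct parts. *)
Definition group_partition (d g : nat) (G : 'I_g -> {set 'I_d}) : Prop :=
  injective G /\ partition [set G i | i : 'I_g] [set: 'I_d].

Definition fair (R : realType) (d g : nat) (G : 'I_g -> {set 'I_d})
    (alpha beta : 'I_g -> R) (k : nat) (p : 'S_d) : Prop :=
  forall i : 'I_g,
    Num.floor (alpha i * k%:R) <= (#|prefix_set p k :&: G i|)%:Z
      <= Num.ceil (beta i * k%:R).

Definition closest_fair (R : realType) (d g : nat) (G : 'I_g -> {set 'I_d})
    (alpha beta : 'I_g -> R) (k : nat) (p q : 'S_d) : Prop :=
  fair G alpha beta k q /\
  forall q' : 'S_d, fair G alpha beta k q' ->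
    (kendall_tau p q <= kendall_tau p q')%N.

(* The model of computation is a unit-cost real RAM.  A program is a finite
   piece of syntax, hence mentions finitely many integer variables, arrays of
   integers and arrays of reals.  Integers are words (see [exec] for the word
   size); reals are exact and support only field operations, comparison and
   the conversion of a word to a real: there is no rounding of reals. *)
Inductive expr : Type :=
| Cst of nat
| Var of nat
| Get of nat & expr  (* Get a e : the entry of integer array a at index e *)
| Add of expr & expr
| Sub of expr & expr.  (* truncated at 0 *)

Inductive rexpr : Type :=
| RGet of nat & expr
| RofN of expr
| RAdd of rexpr & rexpr
| RSub of rexpr & rexpr
| RMul of rexpr & rexpr
| RDiv of rexpr & rexpr.

Inductive test : Type :=
| Le of expr & expr
| RLe of rexpr & rexpr
| Not of test
| And of test & test.

Inductive cmd : Type :=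
| Skip
| Assign of nat & expr
| Store of nat & expr & expr  (* Store a e1 e2 : a[e1] := e2 *)
| RStore of nat & expr & rexpr
| Seq of cmd & cmd
| If of test & cmd & cmd
| While of test & cmd.

Record state (R : realType) : Type := State {
  var : nat -> nat;
  arr : nat -> nat -> nat;
  rarr : nat -> nat -> R }.

Definition upd (T : Type) (f : nat -> T) (x : nat) (v : T) : nat -> T :=
  fun y => if y == x then v else f y.

Definition set_var (R : realType) (s : state R) (x v : nat) : state R :=
  State (upd (var s) x v) (arr s) (rarr s).

Definition set_arr (R : realType) (s : state R) (a j v : nat) : state R :=
  State (var s) (upd (arr s) a (upd (arr s a) j v)) (rarr s).

Definition set_rarr (R : realType) (s : state R) (a j : nat) (v : R) :
    state R :=
  State (var s) (arr s) (upd (rarr s) a (upd (rarr s a) j v)).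

Fixpoint eval (R : realType) (s : state R) (e : expr) : nat :=
  match e with
  | Cst n => n
  | Var x => var s x
  | Get a e1 => arr s a (eval s e1)
  | Add e1 e2 => (eval s e1 + eval s e2)%N
  | Sub e1 e2 => (eval s e1 - eval s e2)%N
  end.

Fixpoint reval (R : realType) (s : state R) (e : rexpr) : R :=
  match e with
  | RGet a e1 => rarr s a (eval s e1)
  | RofN e1 => (eval s e1)%:R
  | RAdd e1 e2 => reval s e1 + reval s e2
  | RSub e1 e2 => reval s e1 - reval s e2
  | RMul e1 e2 => reval s e1 * reval s e2
  | RDiv e1 e2 => reval s e1 / reval s e2
  end.

Fixpoint teval (R : realType) (s : state R) (b : test) : bool :=
  match b with
  | Le e1 e2 => (eval s e1 <= eval s e2)%N
  | RLe e1 e2 => reval s e1 <= reval s e2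
  | Not b1 => ~~ teval s b1
  | And b1 b2 => teval s b1 && teval s b2
  end.

(* Evaluation takes one time unit for each node of the syntax tree. *)
Fixpoint ecost (e : expr) : nat :=
  match e with
  | Cst _ | Var _ => 1
  | Get _ e1 => (ecost e1).+1
  | Add e1 e2 | Sub e1 e2 => (ecost e1 + ecost e2).+1
  end.

Fixpoint rcost (e : rexpr) : nat :=
  match e with
  | RGet _ e1 | RofN e1 => (ecost e1).+1
  | RAdd e1 e2 | RSub e1 e2 | RMul e1 e2 | RDiv e1 e2 =>
      (rcost e1 + rcost e2).+1
  end.

Fixpoint tcost (b : test) : nat :=
  match b with
  | Le e1 e2 => (ecost e1 + ecost e2).+1
  | RLe e1 e2 => (rcost e1 + rcost e2).+1
  | Not b1 => (tcost b1).+1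
  | And b1 b2 => (tcost b1 + tcost b2).+1
  end.

(* exec W c s t s' : started in s, the command c halts in s' after t time
   units.  An execution is stuck, and then derives no [exec], as soon as an
   integer or an address to be written is not smaller than W; with W = O(d)
   the words have log d + O(1) bits. *)
Inductive exec (R : realType) (W : nat) :
    cmd -> state R -> nat -> state R -> Prop :=
| exec_skip s : exec W Skip s 1 s
| exec_assign s x e :
    (eval s e < W)%N ->
    exec W (Assign x e) s (ecost e).+1 (set_var s x (eval s e))
| exec_store s a e1 e2 :
    (eval s e1 < W)%N -> (eval s e2 < W)%N ->
    exec W (Store a e1 e2) s (ecost e1 + ecost e2).+1
      (set_arr s a (eval s e1) (eval s e2))
| exec_rstore s a e1 e2 :
    (eval s e1 < W)%N ->
    exec W (RStore a e1 e2) s (ecost e1 + rcost e2).+1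
      (set_rarr s a (eval s e1) (reval s e2))
| exec_seq s1 s2 s3 c1 c2 t1 t2 :
    exec W c1 s1 t1 s2 -> exec W c2 s2 t2 s3 ->
    exec W (Seq c1 c2) s1 (t1 + t2) s3
| exec_if_true s s' b c1 c2 t :
    teval s b -> exec W c1 s t s' ->
    exec W (If b c1 c2) s (tcost b + t).+1 s'
| exec_if_false s s' b c1 c2 t :
    ~~ teval s b -> exec W c2 s t s' ->
    exec W (If b c1 c2) s (tcost b + t).+1 s'
| exec_while_stop s b c :
    ~~ teval s b ->
    exec W (While b c) s (tcost b).+1 s
| exec_while_loop s1 s2 s3 b c t1 t2 :
    teval s1 b -> exec W c s1 t1 s2 -> exec W (While b c) s2 t2 s3 ->
    exec W (While b c) s1 (tcost b + t1 + t2).+1 s3.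

Definition table (T : Type) (n : nat) (z : T) (f : 'I_n -> T) : nat -> T :=
  fun j => oapp f z (insub j).

Definition group_index (d g : nat) (G : 'I_g -> {set 'I_d}) (x : 'I_d) : nat :=
  if [pick i | x \in G i] is Some i then nat_of_ord i else 0%N.

(* Input format: variables 0, 1, 2 hold d, g, k; integer array 0 is the ranking
   and integer array 1 gives the group of each element; real arrays 0 and 1 are
   alpha and beta.  All other cells are 0. *)
Definition input_state (R : realType) (d g : nat) (p : 'S_d)
    (G : 'I_g -> {set 'I_d}) (alpha beta : 'I_g -> R) (k : nat) : state R :=
  State
    (nth 0%N [:: d; g; k])
    (nth (fun=> 0%N)
      [:: table 0%N (fun i => nat_of_ord (p i)); table 0%N (group_index G)])
    (nth (fun=> 0) [:: table 0 alpha; table 0 beta]).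

(* Output format: variable 3 is 1 when a ranking is returned, in integer
   array 2, and 0 when the absence of a fair ranking is reported. *)
Definition returns_ranking (R : realType) (d : nat) (s : state R) (q : 'S_d) :
    Prop :=
  var s 3 = 1%N /\ forall i : 'I_d, arr s 2 i = nat_of_ord (q i).

Definition reports_none (R : realType) (s : state R) : Prop := var s 3 = 0%N.

Definition correct_output (R : realType) (d g : nat) (p : 'S_d)
    (G : 'I_g -> {set 'I_d}) (alpha beta : 'I_g -> R) (k : nat)
    (s : state R) : Prop :=
  (exists q : 'S_d, returns_ranking s q /\ closest_fair G alpha beta k p q) \/
  (reports_none s /\ ~ exists q : 'S_d, fair G alpha beta k q).

(* Main.v *)
(* A ranking whose k-prefix is a given set S of positions of p has at least as
   many inversions with p as there are pairs of a position outside S before one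
   in S, and moving S to the front without further reordering attains this
   bound.  The bound depends on S through the sum of its positions only, so it
   is minimal for a fair S that meets every initial segment of p in at least as
   many positions as any other fair set does.  Such an S is found greedily: scan
   p and select an element if its group is below its lower quota, or if its
   group is below its upper quota and fewer than k - N such extra elements have
   been selected, where N is the total of the lower quotas.  The quotas are never
   computed: c < floor(alpha k) and c < ceil(beta k) are decided by comparing
   c + 1 with alpha k and c with beta k, so every element costs O(1). *)
Require Import Defs.
From mathcomp Require Import all_boot all_order all_fingroup all_algebra.
From mathcomp Require Import reals zify.

Set Implicit Arguments.
Unset Strict Implicit.
Unset Printing Implicit Defensive.

(** * Inversions forced by a prefix, and rankings attaining them *)

Section Domination.

Variable d : nat.
Implicit Types (T U : {set 'I_d}) (x y : 'I_d).

Definition upto (j : nat) : {set 'I_d} := [set x : 'I_d | x < j].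

Lemma upto_succ x : upto x.+1 = x |: upto x.
Proof. by apply/setP=> y; rewrite !inE ltnS leq_eqVlt. Qed.

Lemma upto_all : upto d = setT.
Proof. by apply/setP=> x; rewrite !inE ltn_ord. Qed.

Lemma card_upto j : j <= d -> #|upto j| = j.
Proof.
elim: j => [|j IH] lejd; first by apply: eq_card0 => x; rewrite inE.
by rewrite (upto_succ (Ordinal lejd)) cardsU1 inE ltnn IH // ltnW.
Qed.

Lemma setU1_upto T x j : j <= x -> (x |: T) :&: upto j = T :&: upto j.
Proof.
move=> lejx; apply/setP=> y; rewrite !inE.
by case: eqP => [->|//]; rewrite ltnNge lejx !andbF.
Qed.

(** [T] consists of positions of the input ranking, not of elements; the pairs are the inversions
    forced by bringing [T] to the front. *)
Definition disorder T : nat :=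
  #|[set ab : 'I_d * 'I_d | [&& ab.1 \notin T, ab.2 \in T & ab.1 < ab.2]]|.

(* Among the pairs [a < b] with [b] in [T], those with [a] in [T] number
   [#|T| * (#|T| - 1) / 2]. *)
Lemma disorder_sum T :
  (disorder T).*2 + #|T| ^ 2 =
  (\sum_(a < d) (#|T| - #|T :&: upto a.+1|)).*2 + #|T|.
Proof.
have row (a : 'I_d) : #|T| - #|T :&: upto a.+1| = \sum_(b in T) (a < b).
  rewrite -(cardsID (upto a.+1) T) addKn -sum1_card big_mkcond /=.
  rewrite [RHS]big_mkcond; apply: eq_bigr => b _.
  by rewrite !inE ltnS -ltnNge; case: (b \in T); case: ltnP.
rewrite (eq_bigr _ (fun a _ => row a)) (bigID (mem T)) /=.
have -> : disorder T = \sum_(a | a \notin T) \sum_(b in T) (a < b).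
  rewrite /disorder -sum1_card pair_big_dep /= big_mkcond /= [RHS]big_mkcond.
  by apply: eq_bigr => -[a b] _; rewrite inE /=; case: (_ \in _); case: (_ \in _);
    case: (_ < _).
set A := \sum_(a in T) _; set B := \sum_(a | a \notin T) _.
suff -> : #|T| ^ 2 = A.*2 + #|T| by rewrite doubleD addnA [B.*2 + _]addnC.
have -> : #|T| ^ 2 = \sum_(a in T) \sum_(b in T) 1.
  by rewrite !sum1_card sum_nat_const mulnn.
have -> : A.*2 = A + \sum_(a in T) \sum_(b in T) (b < a).
  by rewrite -addnn; congr addn; rewrite /A exchange_big.
rewrite -big_split /= -sum1_card -big_split /=.
apply: eq_bigr => a Ta; rewrite -big_split /= (bigD1 a) //=.
rewrite [in RHS](bigD1 a) //= ltnn addn0 add0n addnC; congr addn.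
by apply: eq_bigr => b /andP[_]; rewrite -val_eqE /=; case: ltngtP.
Qed.

(** Sets of equal size share the size terms of [disorder_sum], and each summand there shrinks as the
    initial segment meets more of the set. *)
Lemma disorder_dominated T U :
  #|T| = #|U| -> (forall j, j <= d -> #|U :&: upto j| <= #|T :&: upto j|) ->
  disorder T <= disorder U.
Proof.
move=> eqTU domTU.
suff : \sum_(a < d) (#|T| - #|T :&: upto a.+1|)
       <= \sum_(a < d) (#|U| - #|U :&: upto a.+1|).
  rewrite -leq_double -(leq_add2r #|T|) -disorder_sum {2}eqTU -disorder_sum.
  by rewrite eqTU leq_add2r leq_double.
by apply: leq_sum => a _; rewrite eqTU leq_sub2l // domTU.
Qed.

(* The position of [x] once the elements of [T] are moved to the front and the
   others to the positions from [k] on, without reordering either. *)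
Definition rank k T x : nat :=
  if x \in T then #|T :&: upto x| else k + #|upto x :\: T|.

Lemma rank_lt_size k T x : x \in T -> rank k T x < #|T|.
Proof.
move=> Tx; rewrite /rank Tx [X in _ < X](cardsD1 x) Tx ltnS subset_leq_card //.
by apply/subsetP=> y; rewrite !inE => /andP[-> ltyx]; rewrite -val_eqE /= ltn_eqF.
Qed.

Lemma card_uptoI T x y : x < y -> (x \in T) ->
  #|T :&: upto x| < #|T :&: upto y|.
Proof.
move=> ltxy Tx; apply/proper_card/properP; split.
  by apply/subsetP=> z; rewrite !inE => /andP[-> /ltn_trans]; exact.
by exists x; rewrite !inE ?Tx ?ltnn.
Qed.

Lemma ltn_rank k T x y : (x \in T) = (y \in T) -> x < y ->
  rank k T x < rank k T y.
Proof.
rewrite /rank => eqT ltxy; case: ifP eqT => Tx <-; first exact: card_uptoI.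
by rewrite ltn_add2l !setDE ![upto _ :&: _]setIC card_uptoI // inE Tx.
Qed.

(** Ranks increase on [T] and on its complement, and [k] separates the two images. Size at most [k]
    is enough, so this applies while [T] is still growing. *)
Lemma rank_inj k T : #|T| <= k -> injective (rank k T).
Proof.
move=> leTk x y eqxy; apply/eqP/idPn => neqxy.
wlog ltxy : x y eqxy neqxy / x < y.
  move=> W; case: (ltngtP x y) => [|gtxy|/val_inj exy]; first exact: W.
    by apply: (W y x) => //; rewrite eq_sym.
  by rewrite exy eqxx in neqxy.
have front z : z \in T -> rank k T z < k.
  by move=> Tz; apply: leq_trans leTk; apply: rank_lt_size.
have back z : z \notin T -> k <= rank k T z.
  by move=> /negPf Tz; rewrite /rank Tz leq_addr.
have [Tx|Tx] := boolP (x \in T); have [Ty|Ty] := boolP (y \in T).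
- by have := ltn_rank k (etrans Tx (esym Ty)) ltxy; rewrite eqxy ltnn.
- by have := leq_trans (front x Tx) (back y Ty); rewrite eqxy ltnn.
- by have := leq_trans (front y Ty) (back x Tx); rewrite eqxy ltnn.
by have := @ltn_rank k T x y; rewrite (negPf Tx) (negPf Ty) eqxy ltnn;
  move=> /(_ erefl ltxy).
Qed.

Lemma rank_ltn_front k T x : #|T| = k -> (rank k T x < k) = (x \in T).
Proof.
move=> cT; have [Tx|Tx] := boolP (x \in T).
  by rewrite -{2}cT rank_lt_size.
by rewrite /rank (negPf Tx) ltnNge leq_addr.
Qed.

Lemma rank_ltn k T x : #|T| = k -> rank k T x < d.
Proof.
move=> cT; have leTd : #|T| <= d by rewrite -[X in _ <= X]card_ord max_card.
have [Tx|Tx] := boolP (x \in T).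
  by apply: leq_trans (rank_lt_size k Tx) leTd.
rewrite /rank (negPf Tx) -cT -[X in _ < X]card_ord -(cardsC T) ltn_add2l.
apply/proper_card/properP; split.
  by apply/subsetP=> z; rewrite !inE => /andP[].
by exists x; rewrite !inE ?Tx ?ltnn.
Qed.

(** It maps old positions to new ones, so the rearranged ranking is [(forward cT)^-1 * p], the left
    factor acting first. *)
Definition forward k T (cT : #|T| = k) : 'S_d :=
  perm (fun x y e => rank_inj (eq_leq cT)
    (congr1 val (e : Ordinal (rank_ltn x cT) = Ordinal (rank_ltn y cT)))).

Lemma forwardE k T (cT : #|T| = k) x : forward cT x = rank k T x :> nat.
Proof. by rewrite permE. Qed.

Lemma prefix_imset (p q : 'S_d) k : k <= d ->
  exists2 T : {set 'I_d}, #|T| = k & prefix_set q k = [set p x | x in T].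
Proof.
move=> lekd; exists [set (p^-1)%g y | y in prefix_set q k].
  rewrite card_imset ?card_imset; try exact: perm_inj.
  by rewrite -[RHS](card_upto lekd); apply: eq_card => x; rewrite !inE.
by rewrite -imset_comp -[LHS]imset_id; apply: eq_imset => y; rewrite /= permKV.
Qed.

Lemma in_prefix_set (q : 'S_d) k y : (y \in prefix_set q k) = ((q^-1)%g y < k).
Proof. by rewrite -{1}[y](permKV q) mem_imset ?inE //; apply: perm_inj. Qed.

(** For a counted pair, [q] has the second element inside its [k]-prefix and the first outside,
    hence reverses them; [p] carries positions to elements injectively. *)
Lemma kendall_tau_disorder (p q : 'S_d) k T :
  prefix_set q k = [set p x | x in T] -> disorder T <= kendall_tau p q.
Proof.
move=> preq; pose pp (ab : 'I_d * 'I_d) := (p ab.1, p ab.2).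
have pp_inj : injective pp by move=> [a b] [a' b'] [/perm_inj-> /perm_inj->].
have memp x : ((q^-1)%g (p x) < k) = (x \in T).
  by rewrite -in_prefix_set preq mem_imset //; apply: perm_inj.
rewrite -[disorder T](card_imset _ pp_inj) subset_leq_card //; apply/subsetP=> ab.
case/imsetP=> -[a b]; rewrite inE /= => /and3P[Ta Tb ltab] ->.
rewrite inE /before /= !permK ltab /=.
by rewrite -memp -leqNgt in Ta; rewrite -memp in Tb; apply: leq_trans Ta.
Qed.

(** [rank] keeps the order within [T] and within its complement and puts [T] first, so a reversed
    pair must go from outside [T] into [T]. *)
Lemma kendall_tau_forward (p : 'S_d) k T (cT : #|T| = k) :
  kendall_tau p ((forward cT)^-1 * p)%g <= disorder T.
Proof.
pose pp (ab : 'I_d * 'I_d) := (p ab.1, p ab.2).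
have pp_inj : injective pp by move=> [a b] [a' b'] [/perm_inj-> /perm_inj->].
rewrite -[disorder T](card_imset _ pp_inj) subset_leq_card //.
apply/subsetP=> -[y z].
rewrite inE /before /= !invMg invgK !permM.
set a := (p^-1)%g y; set b := (p^-1)%g z; rewrite !forwardE => /andP[ltab ltr].
apply/imsetP; exists (a, b); last by rewrite /pp /= !permKV.
rewrite inE /= ltab andbT.
have ltNr : ~ (a \in T) = (b \in T).
  by move=> /(ltn_rank k)/(_ ltab); rewrite ltnNge (ltnW ltr).
have [Ta|Ta] := boolP (a \in T); have [Tb|Tb] := boolP (b \in T) => //.
- by case: ltNr; rewrite Ta Tb.
- move: ltr; rewrite ltnNge; case/negP.
  rewrite (leq_trans (ltnW (rank_lt_size k Ta))) // cT leqNgt.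
  by rewrite rank_ltn_front // (negPf Tb).
by case: ltNr; rewrite (negPf Ta) (negPf Tb).
Qed.

Lemma prefix_forward (p : 'S_d) k T (cT : #|T| = k) :
  prefix_set ((forward cT)^-1 * p)%g k = [set p x | x in T].
Proof.
apply/setP=> y; rewrite in_prefix_set invMg invgK permM forwardE.
by rewrite rank_ltn_front // -{2}[y](permKV p) mem_imset //; apply: perm_inj.
Qed.

End Domination.

(** * Invariants of the greedy selection *)

Section Greedy.

Variables (d g k : nat) (col : 'I_d -> 'I_g) (lo hi : 'I_g -> nat).
Implicit Types (A B T U : {set 'I_d}) (x : 'I_d) (i : 'I_g).

Definition cls i : {set 'I_d} := [set x | col x == i].

Definition share A i : nat := #|A :&: cls i|.

Lemma share_subset A B i : A \subset B -> share A i <= share B i.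
Proof. by move=> subAB; rewrite subset_leq_card // setSI. Qed.

Definition meets_quotas T : Prop :=
  #|T| = k /\ forall i, lo i <= share T i <= hi i.

Lemma card_classes A : #|A| = \sum_i share A i.
Proof.
rewrite -sum1_card (partition_big col predT) //=; apply: eq_bigr => i _.
by rewrite /share -sum1_card; apply: eq_bigl => x; rewrite !inE.
Qed.

Lemma cardsU1_class A x i : x \notin A ->
  share (x |: A) i = (col x == i) + share A i.
Proof.
move=> Ax; rewrite /share; case: eqP => [<-|neq].
  have -> : (x |: A) :&: cls (col x) = x |: (A :&: cls (col x)).
    by apply/setP=> y; rewrite !inE; case: (y =P x) => [->|//]; rewrite eqxx.
  by rewrite cardsU1 inE (negPf Ax).
by apply: eq_card => y; rewrite !inE; case: (y =P x) => [->|//];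
  move/eqP/negPf: neq => ->; rewrite !andbF.
Qed.

Definition seen j i : nat := share (upto d j) i.

(** The first [lo i] elements of each class are owed to the lower quotas; this counts the owed ones
    among the first [j] positions, also when a class is too small. *)
Definition reserved j : nat := \sum_i minn (lo i) (seen j i).

Lemma seen_succ x i : seen x.+1 i = (col x == i) + seen x i.
Proof. by rewrite /seen upto_succ cardsU1_class // inE ltnn. Qed.

Lemma reserved_succ x :
  reserved x.+1 = (seen x (col x) < lo (col x)) + reserved x.
Proof.
rewrite /reserved (bigD1 (col x)) // [in RHS](bigD1 (col x)) //= addnA.
congr addn; first by rewrite seen_succ eqxx; lia.
by apply: eq_bigr => i neq; rewrite seen_succ eq_sym (negPf neq).
Qed.

(* [T] is what the greedy rule selects among the first [j] positions, with
   [r] selections beyond the lower quotas still available. *)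
Record greedy j T r : Prop := Greedy {
  greedy_sub : T \subset upto d j;
  greedy_quota i :
    minn (lo i) (seen j i) <= share T i <= maxn (lo i) (hi i);
  greedy_full : 0 < r -> forall i, minn (hi i) (seen j i) <= share T i;
  greedy_card : #|T| + r = k - reserved d + reserved j;
  greedy_dom U : meets_quotas U ->
    forall j', j' <= j -> #|U :&: upto d j'| <= #|T :&: upto d j'| }.

Lemma seen0 i : seen 0 i = 0.
Proof. by apply: eq_card0 => x; rewrite !inE. Qed.

Lemma reserved0 : reserved 0 = 0.
Proof. by apply: big1 => i _; rewrite seen0 minn0. Qed.

Lemma share0 i : share set0 i = 0.
Proof. by rewrite /share set0I cards0. Qed.

Lemma greedy0 : greedy 0 set0 (k - reserved d).
Proof.
split=> [|i|_ i||U _ j]; rewrite ?sub0set ?seen0 ?minn0 ?share0 ?cards0 //.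
  by rewrite reserved0 addn0.
by rewrite leqn0 => /eqP->; rewrite eq_card0 // => x; rewrite !inE andbF.
Qed.

(** [U] shows that each class has at least [lo i] elements, so every minimum in [reserved d] is
    [lo i], and that the subtraction [k - reserved d] is not truncated. *)
Lemma meets_quotas_reserved U : meets_quotas U ->
  reserved d = \sum_i lo i /\ \sum_i lo i <= k.
Proof.
case=> <- qU; split; last first.
  by rewrite card_classes; apply: leq_sum => i _; case/andP: (qU i).
apply: eq_bigr => i _; apply/minn_idPl/(leq_trans (proj1 (andP (qU i)))).
by rewrite /seen upto_all share_subset ?subsetT.
Qed.

(* While [r > 0], [T] has in each class all it may have; once [r = 0], what
   is still to be selected is forced by the lower quotas. *)
Lemma greedy_dom_last j T r U : T \subset upto d j ->
  (0 < r -> forall i, minn (hi i) (seen j i) <= share T i) ->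
  #|T| + r = k - reserved d + reserved j -> meets_quotas U ->
  #|U :&: upto d j| <= #|T :&: upto d j|.
Proof.
move=> /setIidPl-> fullT cardT qU.
have leU i : share (U :&: upto d j) i <= seen j i.
  by rewrite share_subset // subsetIr.
have [r_gt0|r_le0] := ltnP 0 r.
  rewrite card_classes [X in _ <= X]card_classes; apply: leq_sum => i _.
  apply: leq_trans (fullT r_gt0 i); rewrite leq_min leU andbT.
  apply: leq_trans (proj2 (andP (qU.2 i))).
  by rewrite share_subset // subsetIl.
have [resE lok] := meets_quotas_reserved qU.
have : #|U :&: upto d j| + \sum_i lo i <= #|U| + reserved j.
  rewrite !card_classes -!big_split /=; apply: leq_sum => i _.
  have := leU i; have /andP[+ _] := qU.2 i.
  have : share (U :&: upto d j) i <= share U i.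
    by rewrite share_subset // subsetIl.
  by lia.
by rewrite qU.1; lia.
Qed.

Lemma greedy_share_le j T r i : greedy j T r -> share T i <= seen j i.
Proof. by case=> subT *; apply: share_subset. Qed.

Lemma greedy_notin x T r : greedy x T r -> x \notin T.
Proof.
by case=> /subsetP subT *; apply/negP => /subT; rewrite inE ltnn.
Qed.

(** Deciding about [x] leaves shorter initial segments untouched, so only the one ending at [x]
    calls for [greedy_dom_last]. *)
Lemma greedy_succ_dom x T T' r r' : greedy x T r ->
  T' = x |: T \/ T' = T -> T' \subset upto d x.+1 ->
  (0 < r' -> forall i, minn (hi i) (seen x.+1 i) <= #|T' :&: cls i|) ->
  #|T'| + r' = k - reserved d + reserved x.+1 ->
  forall U, meets_quotas U ->
  forall j', j' <= x.+1 -> #|U :&: upto d j'| <= #|T' :&: upto d j'|.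
Proof.
move=> gT eqT' subT' fullT' cardT' U qU j'; rewrite leq_eqVlt.
case/predU1P=> [->|]; first exact: (greedy_dom_last subT' fullT' cardT' qU).
rewrite ltnS => lej'; case: eqT' => ->; rewrite ?setU1_upto //;
  exact: (greedy_dom gT).
Qed.

(** A class short of [lo] has had all its seen elements selected, so [x] is itself a reserved
    element: [#|T|] and [reserved] grow together. *)
Lemma greedy_needed x T r : greedy x T r ->
  share T (col x) < lo (col x) -> greedy x.+1 (x |: T) r.
Proof.
move=> gT needed; have Tx := greedy_notin gT.
have leT i := greedy_share_le i gT.
have subT' : x |: T \subset upto d x.+1.
  by rewrite upto_succ setUS // (greedy_sub gT).
have fullT' : 0 < r ->
    forall i, minn (hi i) (seen x.+1 i) <= share (x |: T) i.
  move=> r_gt0 i; rewrite seen_succ cardsU1_class //.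
  by have := greedy_full gT r_gt0 i; lia.
have cardT' : #|x |: T| + r = k - reserved d + reserved x.+1.
  rewrite cardsU1 Tx reserved_succ -addnA (greedy_card gT) addnCA.
  by have /andP[+ _] := greedy_quota gT (col x); move: needed; lia.
split=> // [i|]; last by apply: greedy_succ_dom gT _ subT' fullT' cardT'; left.
rewrite seen_succ cardsU1_class //; have := greedy_quota gT i.
by case: (col x =P i) needed => [->|_ _] /=; lia.
Qed.

(** Here [seen] has reached [lo], so [reserved] is constant and the new element is paid for out of
    [r]. *)
Lemma greedy_extra x T r : greedy x T r -> lo (col x) <= share T (col x) ->
  0 < r -> share T (col x) < hi (col x) -> greedy x.+1 (x |: T) r.-1.
Proof.
move=> gT enough r_gt0 room; have Tx := greedy_notin gT.
have leT i := greedy_share_le i gT.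
have subT' : x |: T \subset upto d x.+1.
  by rewrite upto_succ setUS // (greedy_sub gT).
have fullT' : 0 < r.-1 ->
    forall i, minn (hi i) (seen x.+1 i) <= share (x |: T) i.
  move=> _ i; rewrite seen_succ cardsU1_class //.
  by have := greedy_full gT r_gt0 i; lia.
have cardT' : #|x |: T| + r.-1 = k - reserved d + reserved x.+1.
  rewrite cardsU1 Tx reserved_succ ltnNge (leq_trans enough (leT _)).
  by have := greedy_card gT; move: r_gt0; case: (r) => //= r' _; rewrite addnS add0n.
split=> // [i|]; last by apply: greedy_succ_dom gT _ subT' fullT' cardT'; left.
rewrite seen_succ cardsU1_class //; have := greedy_quota gT i.
by case: (col x =P i) enough room => [->|_ _] /=; lia.
Qed.

(** While [r > 0], an element is passed over only if its class has reached [hi], which preserves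
    [greedy_full]. *)
Lemma greedy_skip x T r : greedy x T r -> lo (col x) <= share T (col x) ->
  (0 < r -> hi (col x) <= share T (col x)) -> greedy x.+1 T r.
Proof.
move=> gT enough full.
have leT i := greedy_share_le i gT.
have subT' : T \subset upto d x.+1.
  by rewrite upto_succ (subset_trans (greedy_sub gT)) // subsetUr.
have fullT' : 0 < r -> forall i, minn (hi i) (seen x.+1 i) <= share T i.
  move=> r_gt0 i; rewrite seen_succ; have := greedy_full gT r_gt0 i.
  by case: (col x =P i) (full r_gt0) => [->|_ _] /=; lia.
have cardT' : #|T| + r = k - reserved d + reserved x.+1.
  by rewrite reserved_succ (greedy_card gT) ltnNge (leq_trans enough (leT _)).
split=> // [i|]; last by apply: greedy_succ_dom gT _ subT' fullT' cardT'; right.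
rewrite seen_succ; have := greedy_quota gT i.
by case: (col x =P i) enough => [->|_ _] /=; lia.
Qed.

(** Domination at [d] gives [k <= #|T|], and [greedy_card] the converse. Feasibility can thus be
    decided by testing the greedy set alone. *)
Lemma greedy_meets_quotas T r U : greedy d T r -> meets_quotas U ->
  meets_quotas T.
Proof.
move=> gT qU; have := greedy_dom gT qU (leqnn d).
rewrite upto_all !setIT qU.1 => le_kT.
have [resE lok] := meets_quotas_reserved qU.
have cardT := greedy_card gT; split=> [|i].
  by move: resE lok le_kT cardT; lia.
(* [U] witnesses [lo i <= hi i] and [lo i <= seen d i], so the [maxn] and [minn] of [greedy_quota]
   become [hi i] and [lo i]. *)
have /andP[loT hiT] := greedy_quota gT i; have /andP[loU hiU] := qU.2 i.
have leUd : share U i <= seen d i.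
  by rewrite /seen upto_all share_subset ?subsetT.
by lia.
Qed.

End Greedy.

(** * Time bounds and weakest preconditions *)

Fixpoint weight (c : cmd) : nat :=
  match c with
  | Skip => 1
  | Assign _ e => (ecost e).+1
  | Store _ e1 e2 => (ecost e1 + ecost e2).+1
  | RStore _ e1 e2 => (ecost e1 + rcost e2).+1
  | Seq c1 c2 => weight c1 + weight c2
  | If b c1 c2 => (tcost b + maxn (weight c1) (weight c2)).+1
  | While b c => (tcost b + weight c).+1
  end.

Section Execution.

Variables (R : realType) (W : nat).
Implicit Types (c : cmd) (s : state R) (Q : state R -> Prop).

(** The word-size conditions that keep [exec] from getting stuck are included. Loops get [False];
    [halts_for] treats them through an invariant. *)
Fixpoint wp c Q s : Prop :=
  match c with
  | Skip => Q s
  | Assign x e => eval s e < W /\ Q (set_var s x (eval s e))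
  | Store a e1 e2 =>
      [/\ eval s e1 < W, eval s e2 < W & Q (set_arr s a (eval s e1) (eval s e2))]
  | RStore a e1 e2 => eval s e1 < W /\ Q (set_rarr s a (eval s e1) (reval s e2))
  | Seq c1 c2 => wp c1 (wp c2 Q) s
  | If b c1 c2 => if teval s b then wp c1 Q s else wp c2 Q s
  | While _ _ => False
  end.

Definition halts c s n Q : Prop :=
  exists t s', [/\ exec W c s t s', t <= n & Q s'].

Lemma halts_seq c1 c2 s n1 n2 n Q1 Q2 : n1 + n2 <= n ->
  halts c1 s n1 Q1 -> (forall s', Q1 s' -> halts c2 s' n2 Q2) ->
  halts (Seq c1 c2) s n Q2.
Proof.
move=> len [t1 [s1 [ex1 le1 q1]]] /(_ _ q1) [t2 [s2 [ex2 le2 q2]]].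
exists (t1 + t2), s2; split=> //; first exact: exec_seq ex1 ex2.
by apply: leq_trans len; apply: leq_add.
Qed.

Lemma halts_wp c Q s : wp c Q s -> halts c s (weight c) Q.
Proof.
elim: c Q s => [|x e|a e1 e2|a e1 e2|c1 IH1 c2 IH2|b c1 IH1 c2 IH2|//] Q s /=.
- by exists 1, s; split=> //; apply: exec_skip.
- by case=> lte q; eexists _, _; split; [apply: exec_assign|..|exact: q].
- by case=> lt1 lt2 q; eexists _, _; split; [apply: exec_store|..|exact: q].
- by case=> lt1 q; eexists _, _; split; [apply: exec_rstore|..|exact: q].
- by move/IH1 => h1; apply: halts_seq h1 _ => // s' /IH2.
case: ifP => [tb /IH1|/negbT tb /IH2] [t [s' [ex le q]]];
  exists (tcost b + t).+1, s'; split=> //.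
- exact: exec_if_true.
- by rewrite ltnS leq_add2l (leq_trans le) // leq_maxl.
- exact: exec_if_false.
by rewrite ltnS leq_add2l (leq_trans le) // leq_maxr.
Qed.

Lemma wp_assign x e v s Q :
  eval s e = v -> v < W -> Q (set_var s x v) -> wp (Assign x e) Q s.
Proof. by move=> <-. Qed.

Lemma wp_store a e1 e2 i v s Q : eval s e1 = i -> eval s e2 = v ->
  i < W -> v < W -> Q (set_arr s a i v) -> wp (Store a e1 e2) Q s.
Proof. by move=> <- <-. Qed.

Lemma wp_seq c1 c2 s Q : wp c1 (wp c2 Q) s -> wp (Seq c1 c2) Q s.
Proof. by []. Qed.

Lemma wp_if b c1 c2 s Q : (teval s b -> wp c1 Q s) ->
  (~~ teval s b -> wp c2 Q s) -> wp (If b c1 c2) Q s.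
Proof. by move=> h1 h2; rewrite /=; case: ifP => [|/negbT] tb; auto. Qed.

Definition for_loop (y : nat) c : cmd :=
  While (Not (Le (Var y) (Var 4))) (Seq c (Assign 4 (Add (Var 4) (Cst 1)))).

(** A test costs 5, four for its nodes and one for the loop; each turn adds to this the body and 4
    for the increment. *)
Lemma halts_for y c n (I : nat -> state R -> Prop) s :
  (forall j s', I j s' -> var s' y = n /\ var s' 4 = j) ->
  (forall j s', j < n -> I j s' ->
    wp (Seq c (Assign 4 (Add (Var 4) (Cst 1)))) (I j.+1) s') ->
  I 0 s ->
  halts (for_loop y c) s (5 + n * (weight c + 9)) (I n).
Proof.
move=> varsI stepI I0.
suff loop m : forall j s', m = n - j -> j <= n -> I j s' ->
    halts (for_loop y c) s' (5 + m * (weight c + 9)) (I n).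
  by have := loop n 0 s; rewrite subn0; apply.
elim: m => [|m IH] j {I0}s' eqm lejn Ij; have [yn jn] := varsI _ _ Ij.
  have eqjn : j = n by apply/eqP; rewrite eqn_leq lejn -subn_eq0 -eqm.
  exists 5, s'; split; rewrite ?leq_addr //; last by rewrite -eqjn.
  by apply: exec_while_stop; rewrite /= yn jn eqjn leqnn.
have ltjn : j < n by rewrite -subn_gt0 -eqm.
have [t1 [s1 [ex1 le1 I1]]] := halts_wp (stepI _ _ ltjn Ij).
have [||t2 [s2 [ex2 le2 I2]]] := IH j.+1 s1 _ _ I1; [by lia|by []|].
exists (4 + t1 + t2).+1, s2; split=> //.
  by apply: (exec_while_loop _ ex1 ex2); rewrite /= yn jn -ltnNge.
by rewrite mulSn; move: le1 le2; rewrite /=; lia.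
Qed.

End Execution.

(** * The program *)

(* Variable 4 is the loop index, variable 5 the number of selections still
   available beyond the lower quotas, variable 6 the number of selected
   elements.  Array 3 holds, for each group, the number of elements reserved
   by its lower quota, and array 4 the number of elements selected. *)
Definition elt : expr := Get 0 (Var 4).
Definition grp : expr := Get 1 elt.

(* [floor (alpha i * k)] exceeds the entry of [a] at [i]. *)
Definition below_lower (a : nat) (i : expr) : test :=
  RLe (RofN (Add (Get a i) (Cst 1))) (RMul (RGet 0 i) (RofN (Var 2))).

(* [ceil (beta i * k)] does not exceed the entry of [a] at [i]. *)
Definition at_upper (a : nat) (i : expr) : test :=
  RLe (RMul (RGet 1 i) (RofN (Var 2))) (RofN (Get a i)).

(* [ceil (beta i * k)] is less than the entry of [a] at [i]. *)
Definition above_upper (a : nat) (i : expr) : test :=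
  RLe (RAdd (RMul (RGet 1 i) (RofN (Var 2))) (RofN (Cst 1))) (RofN (Get a i)).

Definition increment (a : nat) (i : expr) : cmd :=
  Store a i (Add (Get a i) (Cst 1)).

Definition reserve : cmd :=
  If (below_lower 3 grp)
    (Seq (increment 3 grp) (Assign 5 (Defs.Sub (Var 5) (Cst 1)))) Skip.

Definition select : cmd :=
  Seq (Store 2 (Var 6) elt)
    (Seq (increment 4 grp) (Assign 6 (Add (Var 6) (Cst 1)))).

(** An unselected element goes to [k] plus the number of unselected ones before it, so front and
    rest are written in the same scan. *)
Definition place : cmd :=
  If (below_lower 4 grp) select
    (If (And (Le (Cst 1) (Var 5)) (Not (at_upper 4 grp)))
      (Seq (Assign 5 (Defs.Sub (Var 5) (Cst 1))) select)
      (Store 2 (Add (Var 2) (Defs.Sub (Var 4) (Var 6))) elt)).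

Definition verify : cmd :=
  If (And (Not (below_lower 4 (Var 4))) (Not (above_upper 4 (Var 4))))
    Skip (Assign 3 (Cst 0)).

(** The scans compute the budget for extra selections, place the elements, and check the quotas.
    Flag 3 is raised if exactly [k] elements were selected and lowered by any violating group. *)
Definition fair_program : cmd :=
  Seq (Assign 5 (Var 2))
  (Seq (for_loop 0 reserve)
  (Seq (Assign 4 (Cst 0))
  (Seq (for_loop 0 place)
  (Seq (Seq (Assign 4 (Cst 0))
     (If (And (Le (Var 6) (Var 2)) (Le (Var 2) (Var 6)))
       (Assign 3 (Cst 1)) Skip))
  (for_loop 1 verify))))).


Lemma wp_increment (R : realType) W a e i (s : state R) Q :
  eval s e = i -> i < W -> (arr s a i).+1 < W ->
  Q (set_arr s a i (arr s a i).+1) -> wp W (increment a e) Q s.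
Proof. by move=> ei ltiW ltaW q; apply: wp_store; rewrite /= ?ei ?addn1. Qed.

(** * Deciding roundings by comparing reals *)

Section Rounding.

Import Order.TTheory GRing.Theory Num.Theory.
Local Open Scope ring_scope.

Variable R : realType.
Implicit Types (x : R) (c : nat).

Lemma ltn_absz_floor x c : 0 <= x ->
  (c < `|Num.floor x|)%N = ((c + 1)%:R <= x).
Proof.
move=> x_ge0; rewrite -addn1 -lez_nat gez0_abs ?floor_ge0 //.
by rewrite floor_ge_int -pmulrn.
Qed.

Lemma absz_ceil_leq x c : 0 <= x -> (`|Num.ceil x| <= c)%N = (x <= c%:R).
Proof.
move=> x_ge0; rewrite -lez_nat gez0_abs; last first.
  by rewrite ceil_ge0 (lt_le_trans _ x_ge0) ?ltrN10.
by rewrite ceil_le_int -pmulrn.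
Qed.

Lemma absz_ceil_ltn x c : 0 <= x -> (`|Num.ceil x| < c)%N = (x + 1 <= c%:R).
Proof.
move=> x_ge0; case: c => [|c].
  by rewrite ltn0 leNgt ltr_pwDr.
by rewrite ltnS absz_ceil_leq // -natr1 lerD2r.
Qed.

End Rounding.

(** Disjoint nonempty parts give [g <= d], which makes the scan over the groups linear in [d]. *)
Lemma group_partition_color d g (G : 'I_g -> {set 'I_d}) :
  group_partition G -> 0 < d ->
  g <= d /\ exists f : 'I_d -> 'I_g,
    forall x, (forall i, (x \in G i) = (f x == i)) /\ group_index G x = f x.
Proof.
move=> [G_inj partG] d_gt0; have /and3P[/eqP covG trivG nset0] := partG; split.
  rewrite -[X in _ <= X]card_ord -cardsT (card_partition partG).
  rewrite big_imset /=; last by move=> i j _ _; apply: G_inj.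
  rewrite -[X in X <= _]card_ord -sum1_card leq_sum // => i _.
  rewrite card_gt0; apply: contraNneq nset0 => <-; exact: imset_f.
have memG x : exists i, x \in G i.
  have : x \in cover [set G i | i : 'I_g] by rewrite covG inE.
  by case/bigcupP=> _ /imsetP[i _ ->]; exists i.
have uniqG x i j : x \in G i -> x \in G j -> i = j.
  move=> xi xj; apply: G_inj; apply/eqP/idPn => neq.
  have /trivIsetP/(_ _ _ (imset_f _ _) (imset_f _ _) neq) := trivG.
  by move/(_ isT isT)/disjointFr/(_ xi); rewrite xj.
have [i0 _] := memG (Ordinal d_gt0).
exists (fun x => odflt i0 [pick i | x \in G i]) => x; rewrite /group_index.
case: pickP => /= [i xi|none]; last by case: (memG x) => i; rewrite none.
split=> // j; apply/idP/eqP => [xj|<- //]; exact: uniqG xi xj.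
Qed.

(** * Correctness and running time of the program *)

Section Correctness.

Variables (R : realType) (d g k : nat) (p : 'S_d) (G : 'I_g -> {set 'I_d}).
Variables (alpha beta : 'I_g -> R) (f : 'I_d -> 'I_g) (W : nat).
Hypothesis fG : forall x, (forall i, (x \in G i) = (f x == i)) /\
  group_index G x = f x.
Hypothesis alpha01 : forall i, (0 <= alpha i <= 1)%R.
Hypothesis beta01 : forall i, (0 <= beta i <= 1)%R.
Hypothesis lekd : k <= d.
Hypothesis legd : g <= d.
Hypothesis ltdW : d.*2 < W.
Implicit Types (s : state R) (x y : 'I_d) (i : 'I_g) (T : {set 'I_d}).

Definition lower i : nat := `|Num.floor (alpha i * k%:R)%R|.
Definition upper i : nat := `|Num.ceil (beta i * k%:R)%R|.
Definition color x : 'I_g := f (p x).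

Notation seen := (seen color).
Notation share := (share color).
Notation reserved := (reserved color lower).
Notation greedy := (greedy k color lower upper).
Notation meets_quotas := (meets_quotas k color lower upper).

Lemma lower_ge0 i : (0 <= alpha i * k%:R)%R.
Proof.
by case/andP: (alpha01 i) => ? _; rewrite Num.Theory.mulr_ge0 ?Num.Theory.ler0n.
Qed.

Lemma upper_ge0 i : (0 <= beta i * k%:R)%R.
Proof.
by case/andP: (beta01 i) => ? _; rewrite Num.Theory.mulr_ge0 ?Num.Theory.ler0n.
Qed.

Lemma card_image_group T i : #|[set p x | x in T] :&: G i| = share T i.
Proof.
rewrite -[share T i](card_imset _ (@perm_inj _ p)).
apply: eq_card => y; rewrite -[y](permKV p) !inE (fG _).1.
by rewrite !(mem_imset _ _ (@perm_inj _ p)) !inE.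
Qed.

Lemma fair_meets_quotas (q : 'S_d) T :
  #|T| = k -> prefix_set q k = [set p x | x in T] ->
  fair G alpha beta k q <-> meets_quotas T.
Proof.
move=> cT preq; have E i : (Num.floor (alpha i * k%:R)
    <= (#|prefix_set q k :&: G i|)%:Z <= Num.ceil (beta i * k%:R))%R =
    (lower i <= share T i <= upper i).
  rewrite preq card_image_group -!lez_nat /lower /upper !gez0_abs //.
    rewrite Num.Theory.ceil_ge0 (Order.POrderTheory.lt_le_trans _ (upper_ge0 i)) //.
    by rewrite Num.Theory.ltrN10.
  by rewrite Num.Theory.floor_ge0 lower_ge0.
by split=> [h|[_ h] i]; [split=> // i; rewrite -E|rewrite E].
Qed.

(** For a fair rival with prefix positions [U], the distances are compared through
    [disorder T <= disorder U]. *)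
Lemma kendall_tau_optimal T (cT : #|T| = k) r : greedy d T r ->
  meets_quotas T -> closest_fair G alpha beta k p ((forward cT)^-1 * p)%g.
Proof.
move=> gT qT; split; first exact/(fair_meets_quotas cT (prefix_forward p cT)).
move=> q' fairq'; have [U cU preU] := prefix_imset p q' lekd.
have qU := (fair_meets_quotas cU preU).1 fairq'.
apply: leq_trans (kendall_tau_forward p cT) _.
apply: leq_trans (kendall_tau_disorder preU).
by apply: disorder_dominated (greedy_dom gT qU); rewrite cT.
Qed.

(** These cells are never written by the program, so the predicate survives each of its updates by
    computation. *)
Definition reads_input s : Prop :=
  [/\ var s 0 = d, var s 1 = g, var s 2 = k,
      forall x, arr s 0 x = p x /\ arr s 1 x = f x &
      forall i, rarr s 0 i = alpha i /\ rarr s 1 i = beta i].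

Lemma eval_elt s x : reads_input s -> var s 4 = x -> eval s elt = p x.
Proof. by case=> _ _ _ /(_ x)[<- _] _ /= ->. Qed.

Lemma eval_grp s x : reads_input s -> var s 4 = x -> eval s grp = color x.
Proof.
move=> inp jx; have := eval_elt inp jx.
by case: inp => _ _ _ /(_ (p x))[_ <-] _ /= ->.
Qed.

Lemma teval_below_lower s a e i : reads_input s -> eval s e = i ->
  teval s (below_lower a e) = (arr s a i < lower i).
Proof.
case=> _ _ k2 _ /(_ i)[ai _] /= ->.
by rewrite ai k2 ltn_absz_floor ?lower_ge0.
Qed.

Lemma teval_at_upper s a e i : reads_input s -> eval s e = i ->
  teval s (at_upper a e) = (upper i <= arr s a i).
Proof.
case=> _ _ k2 _ /(_ i)[_ bi] /= ->.
by rewrite bi k2 absz_ceil_leq ?upper_ge0.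
Qed.

Lemma teval_above_upper s a e i : reads_input s -> eval s e = i ->
  teval s (above_upper a e) = (upper i < arr s a i).
Proof.
case=> _ _ k2 _ /(_ i)[_ bi] /= ->.
by rewrite bi k2 absz_ceil_ltn ?upper_ge0.
Qed.

Definition running j s : Prop := reads_input s /\ var s 4 = j.

Lemma running_next j s (Q : state R -> Prop) : j < d -> running j s ->
  Q (set_var s 4 j.+1) ->
  wp W (Assign 4 (Add (Var 4) (Cst 1))) Q s.
Proof.
by move=> ltjd [_ jj] q; apply: (wp_assign _ _ q); rewrite /= ?jj ?addn1 //; lia.
Qed.

Lemma ltn_ordW n (i : 'I_n) : n <= d -> i < W.
Proof. by move=> lend; have := ltn_ord i; lia. Qed.

Definition reserving j s : Prop :=
  [/\ running j s, var s 5 = k - reserved j,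
      forall i, arr s 3 i = minn (lower i) (seen j i) &
      [/\ var s 3 = 0, var s 6 = 0 & forall i, arr s 4 i = 0]].

Lemma reserve_step x s : reserving x s ->
  wp W (Seq reserve (Assign 4 (Add (Var 4) (Cst 1)))) (reserving x.+1) s.
Proof.
case=> run v5 a3 rest; have [inp v4] := run.
have grpx := eval_grp inp v4; apply: wp_seq.
have resx := reserved_succ color lower x.
apply: wp_if; rewrite (teval_below_lower _ inp grpx) a3 => below.
  have {}below : seen x (color x) < lower (color x) by lia.
  rewrite below in resx.
  have leseen : seen x (color x) <= x.
    rewrite -[X in _ <= X](card_upto (ltnW (ltn_ord x))).
    by rewrite subset_leq_card // subsetIl.
  apply: wp_seq; apply: (wp_increment grpx); rewrite ?(ltn_ordW _ legd) ?a3 //.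
    by have := ltn_ord x; lia.
  apply: (wp_assign (erefl _)); first by rewrite /= v5; lia.
  apply: (running_next (j := x)) => //.
  split=> //= [|i]; first by rewrite /upd /= v5 resx addnC subnDA.
  rewrite /upd /= seen_succ.
  case: eqP => [/val_inj->|neq]; first by rewrite eqxx; lia.
  by case: eqP => [e|_]; [case: neq; rewrite e | rewrite a3].
have {}below : seen x (color x) < lower (color x) = false by lia.
apply: (running_next (j := x)) => //.
split=> //= [|i]; first by rewrite /upd /= v5 resx below.
by rewrite a3 seen_succ; case: eqP => [<-|//]; lia.
Qed.

(** The guard [#|T| <= k] is there because on infeasible inputs too many selections can make the two
    output zones overlap. *)
Definition placed j T (out : nat -> nat) : Prop :=
  #|T| <= k -> forall x, x < j -> out (rank k T x) = p x.

(** Ranks of earlier positions depend only on earlier decisions, and injectivity of [rank] keeps the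
    new write off their cells. *)
Lemma placed_succ x T T' out : T \subset T' ->
  (forall y, y < x -> (y \in T') = (y \in T)) -> placed x T out ->
  placed x.+1 T' (upd out (rank k T' x) (p x)).
Proof.
move=> subT eqT outT leT' y; rewrite ltnS leq_eqVlt => /predU1P[/val_inj->|ltyx].
  by rewrite /upd eqxx.
rewrite /upd (inj_eq (rank_inj leT')) -val_eqE /= ltn_eqF //.
rewrite -(outT (leq_trans (subset_leq_card subT) leT') y ltyx) /rank eqT //.
have eqTz (z : 'I_d) : z < y -> (z \in T') = (z \in T).
  by move=> ltzy; apply: eqT; apply: ltn_trans ltyx.
by congr out; case: ifP => _; [|congr addn]; apply: eq_card => z;
  rewrite !inE; case: ltnP => [/eqTz->|]; rewrite ?andbF.
Qed.

Definition placing j s : Prop :=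
  [/\ running j s, var s 3 = 0, var s 5 <= k & exists T,
    [/\ greedy j T (var s 5), var s 6 = #|T|,
        forall i, arr s 4 i = share T i & placed j T (arr s 2)]].

(** This serves both selecting branches: [r] is the budget before the decision and [var s 5] the one
    after it. *)
Lemma select_step x s T r : running x s -> var s 3 = 0 -> var s 5 <= k ->
  greedy x T r -> var s 6 = #|T| ->
  (forall i, arr s 4 i = share T i) -> placed x T (arr s 2) ->
  greedy x.+1 (x |: T) (var s 5) ->
  wp W select (wp W (Assign 4 (Add (Var 4) (Cst 1))) (placing x.+1)) s.
Proof.
move=> run v3 v5 gT v6 a4 a2 gT'; have [inp v4] := run.
have cT : #|T| <= x.
  rewrite -[X in _ <= X](card_upto (ltnW (ltn_ord x))).
  exact: subset_leq_card (greedy_sub gT).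
have Tx := greedy_notin gT; have ltxd := ltn_ord x.
apply: wp_seq; apply: (wp_store (e1 := Var 6) v6 (eval_elt inp v4)).
- by lia.
- exact: ltn_ordW.
apply: wp_seq; apply: (wp_increment (i := color x)).
- exact: (eval_grp (x := x)).
- exact: ltn_ordW.
- have := greedy_share_le (color x) gT; rewrite /= /upd /= a4.
  have : seen x (color x) <= x.
    by rewrite -[X in _ <= X](card_upto (ltnW ltxd)) subset_leq_card // subsetIl.
  by lia.
apply: (wp_assign (erefl _)); first by rewrite /= /upd /= v6; lia.
apply: (running_next (j := x)) => //.
split=> //; exists (x |: T); split=> [//||i|].
- by rewrite /= /upd /= v6 cardsU1 Tx addnC.
- rewrite /= /upd /= cardsU1_class // !a4.
  case: (eqVneq (color x) i) => [->|]; rewrite ?eqxx //.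
  by rewrite eq_sym -val_eqE => /negPf->.
have -> : #|T| = rank k (x |: T) x.
  rewrite /rank setU11 setU1_upto //.
  by rewrite (setIidPl (greedy_sub gT)).
apply: (placed_succ _ _ a2) => [|y ltyx]; first exact: subsetUr.
by rewrite !inE -val_eqE ltn_eqF.
Qed.

Lemma place_step x s : placing x s ->
  wp W (Seq place (Assign 4 (Add (Var 4) (Cst 1)))) (placing x.+1) s.
Proof.
case=> run v3 v5 [T [gT v6 a4 a2]]; have [inp v4] := run.
have grpx := eval_grp inp v4; apply: wp_seq.
apply: wp_if; rewrite (teval_below_lower _ inp grpx) a4 => below.
  exact: (select_step run v3 v5 gT v6 a4 a2 (greedy_needed gT below)).
rewrite -leqNgt in below.
have extraE : teval s (And (Le (Cst 1) (Var 5)) (Not (at_upper 4 grp))) =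
    (0 < var s 5) && (share T (color x) < upper (color x)).
  rewrite -[LHS]/((0 < var s 5) && ~~ teval s (at_upper 4 grp)).
  by rewrite (teval_at_upper _ inp grpx) a4 -ltnNge.
apply: wp_if; rewrite extraE => extra.
  case/andP: extra => r_gt0 room.
  apply: wp_seq; apply: wp_assign; [exact: erefl|rewrite /=; lia|].
  set s1 := set_var _ _ _.
  apply: (@select_step x s1 T (var s 5) run v3 _ gT v6 a4 a2).
    by rewrite /= /upd /=; lia.
  by rewrite /= /upd /= subn1; apply: greedy_extra.
have gT' : greedy x.+1 T (var s 5).
  apply: greedy_skip gT below _ => r_gt0.
  by rewrite r_gt0 -leqNgt in extra.
have Tx := greedy_notin gT.
have idxE : eval s (Add (Var 2) (Defs.Sub (Var 4) (Var 6))) = k + (x - #|T|).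
  by rewrite /= v4 v6; case: inp => _ _ -> _ _.
apply: (wp_store idxE (eval_elt inp v4)).
(* With fewer than [k] selections the index may reach [d] or more, but it stays below [2 d]; hence
   the assumption [d.*2 < W]. *)
- by have := ltn_ord x; lia.
- exact: ltn_ordW.
apply: (running_next (j := x)) => //.
split=> //; exists T; split=> //.
have -> : k + (x - #|T|) = rank k T x.
  rewrite /rank (negPf Tx) cardsD (card_upto (ltnW (ltn_ord x))).
  by rewrite (setIidPr (greedy_sub gT)).
exact: placed_succ a2.
Qed.

Definition within_quotas T i : bool := lower i <= share T i <= upper i.

Definition verifying T j s : Prop :=
  [/\ running j s, placed d T (arr s 2), forall i, arr s 4 i = share T i &
      var s 3 = (#|T| == k) && [forall i : 'I_g, (i < j) ==> within_quotas T i]].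

Lemma verify_step T i s : verifying T i s ->
  wp W (Seq verify (Assign 4 (Add (Var 4) (Cst 1)))) (verifying T i.+1) s.
Proof.
case=> run a2 a4 v3; have [inp v4] := run.
have split_quota : [forall i' : 'I_g, (i' < i.+1) ==> within_quotas T i'] =
    [forall i' : 'I_g, (i' < i) ==> within_quotas T i'] && within_quotas T i.
  apply/forallP/andP => [all|[/forallP all_i ok_i] i'].
    split; last by have := all i; rewrite ltnSn.
    by apply/forallP=> i'; apply/implyP=> /ltnW; apply/implyP/all.
  rewrite ltnS leq_eqVlt; apply/implyP=> /predU1P[/val_inj->//|].
  exact/implyP.
have ltid : i < d by apply: leq_trans legd; apply: ltn_ord.
have okE : teval s (And (Not (below_lower 4 (Var 4)))
                        (Not (above_upper 4 (Var 4)))) = within_quotas T i.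
  rewrite -[LHS]/(~~ teval s (below_lower 4 (Var 4))
                  && ~~ teval s (above_upper 4 (Var 4))).
  by rewrite (teval_below_lower _ (e := Var 4) inp v4)
    (teval_above_upper _ (e := Var 4) inp v4) a4 -!leqNgt.
apply: wp_seq; apply: wp_if; rewrite okE => ok.
  apply: (running_next (j := i)) => //; split=> //.
  by rewrite split_quota ok andbT.
apply: wp_assign; [exact: erefl|rewrite /=; lia|].
apply: (running_next (j := i)) => //; split=> //.
by rewrite split_quota (negPf ok) !andbF.
Qed.

(** A lowered flag means that the greedy set fails the quotas, and then [greedy_meets_quotas]
    excludes every fair ranking. *)
Lemma verified_correct T r s : greedy d T r -> verifying T g s ->
  correct_output p G alpha beta k s.
Proof.
move=> gT [_ a2 _ v3].
have qTP : reflect (meets_quotas T)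
    ((#|T| == k) && [forall i : 'I_g, (i < g) ==> within_quotas T i]).
  apply: (iffP andP) => [[/eqP cT /forallP all]|[cT all]].
    by split=> // i; have := all i; rewrite ltn_ord.
  by split; [apply/eqP | apply/forallP=> i; apply/implyP=> _; apply: all].
move: v3; case: qTP => [qT v3|nqT v3]; last first.
  right; split=> // -[q' fairq']; apply: nqT.
  have [U cU preU] := prefix_imset p q' lekd.
  by apply: greedy_meets_quotas gT ((fair_meets_quotas cU preU).1 fairq').
have [cT _] := qT; left; exists ((forward cT)^-1 * p)%g.
split; last exact: kendall_tau_optimal gT qT.
split=> // i; rewrite -[i](permKV (forward cT)) forwardE a2 ?cT ?ltn_ord //.
by rewrite permM permK.
Qed.

(** The loops cost 39, 66 and 38 per turn, the body weight plus 9. With [g <= d] the total is at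
    most [143 d + 31], hence at most [200 d] for [d > 0]. *)
Lemma fair_program_halts s : reads_input s -> var s 3 = 0 -> var s 6 = 0 ->
  (forall i, arr s 3 i = 0) -> (forall i, arr s 4 i = 0) -> var s 4 = 0 -> 0 < d ->
  halts W fair_program s (200 * d) (correct_output p G alpha beta k).
Proof.
move=> inp v3 v6 a3 a4 v4 d_gt0.
apply: (@halts_seq _ _ _ _ _ 2 (200 * d - 2) _ (reserving 0)); first by lia.
  apply: (@halts_wp _ _ (Assign 5 (Var 2))).
  apply: (wp_assign (erefl _)) => /=.
    by case: (inp) => _ _ -> _ _; lia.
  split=> // [|i]; last by rewrite /= a3 seen0 minn0.
  by rewrite /= /upd /= reserved0 subn0; case: inp.
move=> s1 start1.
apply: (@halts_seq _ _ _ _ _ (5 + d * 39) (200 * d - 2 - (5 + d * 39)) _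
  (reserving d)); first by lia.
  apply: halts_for start1 => [j s2 [[[]]]//|j s2 ltjd].
  exact: (reserve_step (x := Ordinal ltjd)).
move=> s2 [[inp2 v42] v52 _ [v32 v62 a42]].
apply: (@halts_seq _ _ _ _ _ 2 (200 * d - 9 - d * 39) _ (placing 0)); first by lia.
  apply: (@halts_wp _ _ (Assign 4 (Cst 0))).
  apply: (wp_assign (erefl _)) => /=; first by lia.
  split=> //; first by rewrite /= /upd /= v52 leq_subr.
  exists set0; split=> [|||//].
  - by rewrite /= /upd /= v52; apply: greedy0.
  - by rewrite /= cards0.
  by move=> i; rewrite share0; apply: a42.
move=> s3 placing3.
apply: (@halts_seq _ _ _ _ _ (5 + d * 66) (200 * d - 14 - d * 105) _
  (placing d)); first by lia.
  apply: halts_for placing3 => [j s4 [[[]]]//|j s4 ltjd].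
  exact: (place_step (x := Ordinal ltjd)).
move=> s4 [[inp4 v44] v34 _ [T [gT v64 a44 a24]]].
apply: (@halts_seq _ _ _ _ _ 12 (5 + g * 38) _ (verifying T 0)); first by lia.
  apply: (halts_wp (c := Seq (Assign 4 (Cst 0)) _)).
  apply: wp_seq; apply: (wp_assign (erefl _)); first by rewrite /=; lia.
  have all0 : [forall i : 'I_g, (i < 0) ==> within_quotas T i].
    by apply/forallP=> i; rewrite ltn0.
  set s' := set_var _ _ _.
  have sizeE : teval s' (And (Le (Var 6) (Var 2)) (Le (Var 2) (Var 6))) =
      (#|T| == k).
    rewrite -[LHS]/((var s4 6 <= var s4 2) && (var s4 2 <= var s4 6)) v64.
    by case: inp4 => _ _ -> _ _; rewrite eqn_leq.
  apply: wp_if; rewrite sizeE => cT.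
    by apply: wp_assign; [exact: erefl|rewrite /=; lia|split; rewrite ?cT ?all0].
  by split=> //; rewrite (negPf cT).
move=> s5 ver5.
have [t [s6 [ex6 le6 ver6]]] : halts W (for_loop 1 verify) s5 (5 + g * 38)
    (verifying T g).
  apply: halts_for ver5 => [j s6 [[[]]]//|j s6 ltjg].
  exact: (verify_step (i := Ordinal ltjg)).
by exists t, s6; split=> //; apply: verified_correct gT ver6.
Qed.

End Correctness.

Local Open Scope ring_scope.

Theorem theorem1 (R : realType) :
  exists (P : cmd) (C : nat),
    forall (d g : nat) (p : 'S_d) (G : 'I_g -> {set 'I_d})
      (alpha beta : 'I_g -> R) (k : nat),
    group_partition G ->
    (forall i : 'I_g, 0 <= alpha i <= 1) ->
    (forall i : 'I_g, 0 <= beta i <= 1) ->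
    (1 <= k <= d)%N ->
    exists (t : nat) (s : state R),
      exec (C * d)%N P (input_state p G alpha beta k) t s /\
      (t <= C * d)%N /\
      correct_output p G alpha beta k s.
Proof.
(* The constant 200 comes from the time bound; as a word-size factor it only has to exceed 2. *)
exists fair_program, 200 => d g p G alpha beta k partG alpha01 beta01.
case/andP=> k_gt0 lekd; have d_gt0 := leq_trans k_gt0 lekd.
have [legd [f fG]] := group_partition_color partG d_gt0.
have ltdW : (d.*2 < 200 * d)%N by lia.
have [||||||//|t [s [ex le correct]]] := @fair_program_halts R d g k p G alpha
  beta f (200 * d) fG alpha01 beta01 lekd legd ltdW (input_state p G alpha beta k);
  try by [].
  by split=> // x; rewrite /= /table !valK /= ?(fG _).2.
by exists t, s.
Qed.
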